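(* Let $H$ be a finite linear cycle set with abelian adjoint group and let $I$ be an abelian group with maps $\diamond,\prec$ as in the context. Let $\gamma_1,\dots,\gamma_n\in I$, $\alpha:=\alpha_{\gamma_1,\dots,\gamma_n}$, and let $(\alpha,-f)$ be a $2$-cocycle. Then for all $\ell\in\mathbb N$ and $h_1,\dots,h_\ell,m\in H$, $$\begin{aligned}f(h_1\times\cdots\times h_\ell,m)&=\sum_{j=1}^{\ell}(h_{j+1}\times\cdots\times h_\ell)\diamond f\bigl(h_j,(h_1\times\cdots\times h_{j-1})\cdot m\bigr)\\&\quad+\sum_{j=1}^{\ell-1}\Bigl((h_{j+1}\times\cdots\times h_\ell)\diamond f\bigl(h_j,{}^{h_j}(h_{j+1}\times\cdots\times h_\ell)\bigr)\Bigr)\prec\bigl((h_1\times\cdots\times h_\ell)\cdot m\bigr)\\&\quad-\sum_{j=1}^{\ell-1}\Bigl((h_j\times\cdots\times h_\ell)\diamond\alpha\bigl(h_j,{}^{h_j}(h_{j+1}\times\cdots\times h_\ell)\bigr)\Bigr)\prec\bigl((h_1\times\cdots\times h_\ell)\cdot m\bigr),\end{aligned}$$ where an empty $\times$-product is $0$.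
   Context: Linear cycle sets. A linear cycle set is an additive abelian group $H$ with a binary operation $\cdot$ such that each map $l\mapsto h\cdot l$ is bijective and $h\cdot(l+m)=h\cdot l+h\cdot m$, $(h+l)\cdot m=(h\cdot l)\cdot(h\cdot m)$ for all $h,l,m\in H$. The inverse of $l\mapsto h\cdot l$ is written $l\mapsto{}^hl$. Setting $h\times l:=h+{}^hl$ makes $H$ a group with neutral element $0$ (the adjoint group). Actions. $I$ is an abelian group and $\diamond\colon H\times I\to I$, $\prec\colon I\times H\to I$ are maps such that, writing $y^h:=y-y\prec h$ and $y\triangleleft h:=h\diamond(y-y\prec h)$, for all $h,l\in H$ and $y,z\in I$: $y\triangleleft(h\times l)=(y\triangleleft h)\triangleleft l$, $(y+z)\triangleleft h=y\triangleleft h+z\triangleleft h$, $y\triangleleft 0=y$; $(l\times h)\diamond y=h\diamond(l\diamond y)$, $h\diamond(y+z)=h\diamond y+h\diamond z$, $0\diamond y=y$; $y^{h+l}+y=y^h+y^l$, $0^h=0$. Standing setting. As an additive group $H=\mathbb Z_{d_1}\oplus\cdots\oplus\mathbb Z_{d_n}$ (finite cyclic groups), and the group $(H,\times)$ is abelian. The map $\alpha$. For $\gamma_1,\dots,\gamma_n\in I$, $\alpha_{\gamma_1,\dots,\gamma_n}\colon H\times H\to I$ sends $(h,l)$ to $\sum_{i:\,h_i+l_i\ge d_i}\gamma_i$, where $h_i,l_i\in\{0,\dots,d_i-1\}$ represent the $i$-th coordinates of $h,l$. 2-cocycles. For $f\colon H\times H\to I$, the pair $(\alpha,-f)$ is a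 $2$-cocycle if $f(h,0)=f(0,h)=0$ for all $h$, and for all $h,l,m\in H$: $f(h,l+m)=f(h,l)+f(h,m)+\alpha(h\cdot l,h\cdot m)-h\diamond\alpha(l,m)$, and $f(h+l,m)=f(h\cdot l,h\cdot m)+(h\cdot l)\diamond f(h,m)+\bigl((h\cdot l)\diamond f(h,l)\bigr)\prec\bigl((h+l)\cdot m\bigr)-\bigl((h+l)\diamond\alpha(h,l)\bigr)\prec\bigl((h+l)\cdot m\bigr)$. *)

(* Defs.v *)
From HB Require Import structures.
From mathcomp Require Import all_boot all_order all_algebra.

Set Implicit Arguments.
Unset Strict Implicit.
Unset Printing Implicit Defensive.

Import GRing.Theory.
Local Open Scope ring_scope.

Record linear_cycle_set (H : zmodType) := LinearCycleSet {
  dot : H -> H -> H;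
  dot_bij : forall h, bijective (dot h);
  dotDr : forall h l m, dot h (l + m) = dot h l + dot h m;
  dotDl : forall h l m, dot (h + l) m = dot (dot h l) (dot h m)
}.

Section Adjoint.
Variables (H : zmodType) (L : linear_cycle_set H).

Fact dot_surj h l : exists k, dot L h k == l.
Proof. by case: (dot_bij L h) => g _ gK; exists (g l); rewrite gK. Qed.

(* ^h l, the inverse of l |-> h . l *)
Definition idot (h l : H) : H := xchoose (dot_surj h l).

Lemma idotK h : cancel (idot h) (dot L h).
Proof. by move=> l; apply/eqP/(xchooseP (dot_surj h l)). Qed.

Lemma dotK h : cancel (dot L h) (idot h).
Proof. by move=> l; apply: (bij_inj (dot_bij L h)); rewrite idotK. Qed.

(* h \times l, the adjoint group law *)
Definition adj (h l : H) : H := h + idot h l.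

End Adjoint.

(* [act_exp] is y^h and [act_tri] is y \triangleleft h. *)
Definition act_exp (H I : zmodType) (prec : I -> H -> I) (y : I) (h : H) : I :=
  y - prec y h.

Definition act_tri (H I : zmodType) (dia : H -> I -> I) (prec : I -> H -> I)
    (y : I) (h : H) : I :=
  dia h (y - prec y h).

Record lcs_action (H : zmodType) (L : linear_cycle_set H) (I : zmodType) :=
  LcsAction {
  dia : H -> I -> I;
  prec : I -> H -> I;
  triM : forall y h l, act_tri dia prec y (adj L h l) =
                       act_tri dia prec (act_tri dia prec y h) l;
  triD : forall y z h, act_tri dia prec (y + z) h =
                       act_tri dia prec y h + act_tri dia prec z h;
  tri0 : forall y, act_tri dia prec y 0 = y;
  diaM : forall l h y, dia (adj L l h) y = dia h (dia l y);
  diaD : forall h y z, dia h (y + z) = dia h y + dia h z;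
  dia0 : forall y, dia 0 y = y;
  expD : forall y h l, act_exp prec y (h + l) + y =
                       act_exp prec y h + act_exp prec y l;
  exp0 : forall h, act_exp prec 0 h = 0
}.

(* Z_{d_1} (+) ... (+) Z_{d_n}, for positive d_i: ['I_p] carries its canonical
   group structure (addition mod p) only when p is a successor, and ['Z_1] is
   Z/2Z, hence [(d i).-1.+1], which is d_i as soon as d_i > 0. *)
Definition cyclic_sum (n : nat) (d : 'I_n -> nat) : Type :=
  {dffun forall i : 'I_n, 'I_(d i).-1.+1}.

Section CyclicSum.
Variables (n : nat) (d : 'I_n -> nat).

HB.instance Definition _ := Finite.on (cyclic_sum d).

Implicit Types u v w : cyclic_sum d.

Definition cs_zero : cyclic_sum d := [ffun i => 0 : 'I_(d i).-1.+1].
Definition cs_opp u : cyclic_sum d := [ffun i => - u i : 'I_(d i).-1.+1].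
Definition cs_add u v : cyclic_sum d :=
  [ffun i => u i + v i : 'I_(d i).-1.+1].

Fact cs_addA : associative cs_add.
Proof. by move=> u v w; apply/ffunP => i; rewrite !ffunE addrA. Qed.
Fact cs_addC : commutative cs_add.
Proof. by move=> u v; apply/ffunP => i; rewrite !ffunE addrC. Qed.
Fact cs_add0 : left_id cs_zero cs_add.
Proof. by move=> u; apply/ffunP => i; rewrite !ffunE add0r. Qed.
Fact cs_addN : left_inverse cs_zero cs_opp cs_add.
Proof. by move=> u; apply/ffunP => i; rewrite !ffunE addNr. Qed.

HB.instance Definition _ :=
  GRing.isZmodule.Build (cyclic_sum d) cs_addA cs_addC cs_add0 cs_addN.

End CyclicSum.

Definition alpha (n : nat) (d : 'I_n -> nat) (I : zmodType) (gamma : 'I_n -> I)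
    (h l : cyclic_sum d) : I :=
  \sum_(i < n | (d i <= nat_of_ord (h i) + nat_of_ord (l i))%N) gamma i.

(* "(a, - f) is a 2-cocycle", stated in terms of f. *)
Record is_2cocycle_opp (H : zmodType) (L : linear_cycle_set H) (I : zmodType)
    (A : lcs_action L I) (a f : H -> H -> I) : Prop := Is2CocycleOpp {
  cocycle_r0 : forall h, f h 0 = 0;
  cocycle_l0 : forall h, f 0 h = 0;
  cocycle_Dr : forall h l m,
    f h (l + m) =
      f h l + f h m + a (dot L h l) (dot L h m) - dia A h (a l m);
  cocycle_Dl : forall h l m,
    f (h + l) m =
      f (dot L h l) (dot L h m)
      + dia A (dot L h l) (f h m)
      + prec A (dia A (dot L h l) (f h l)) (dot L (h + l) m)
      - prec A (dia A (h + l) (a h l)) (dot L (h + l) m)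
}.

(* Main.v *)
(* Peel the product from the left: taking l = ^h P in the second cocycle
   identity, [h + l] is [h \times P] and [h . l] is [P], so [f (h \times P) m]
   reduces to [f P (h . m)], and induction applies. *)
Require Import Defs.
From HB Require Import structures.
From mathcomp Require Import all_boot all_order all_algebra.

Import GRing.Theory.
Local Open Scope ring_scope.

(* [adj] is not registered as a monoid law, hence no [big_mkcond]. *)
Lemma big_ord_recl_cond (T : Type) (idx : T) (op : T -> T -> T) (n : nat)
    (P : pred 'I_n.+1) (F : 'I_n.+1 -> T) :
  let x := \big[op/idx]_(i < n | P (lift ord0 i)) F (lift ord0 i) in
  \big[op/idx]_(i < n.+1 | P i) F i = if P ord0 then op (F ord0) x else x.
Proof.
have enumE k : index_enum 'I_k = enum 'I_k.
  by rewrite enumT /index_enum unlock.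
by rewrite /= !enumE enum_ordSl big_cons big_map.
Qed.

Section LinearCycleSet.
Variables (H : zmodType) (L : linear_cycle_set H).

(** Since [dot L 0 0 = 0] by additivity, [dotDl] at [0 + 0] makes [dot L 0] idempotent, and an
    injective idempotent map is the identity. *)
Lemma dot0l m : dot L 0 m = m.
Proof.
have dotr0 : dot L 0 0 = 0 by apply: (addrI (dot L 0 0)); rewrite -dotDr !addr0.
by apply: (bij_inj (dot_bij L 0)); rewrite -[in RHS](addr0 0) dotDl dotr0.
Qed.

Lemma adjr0 h : adj L h 0 = h.
Proof.
rewrite /adj; suff -> : idot L h 0 = 0 by rewrite addr0.
apply: (bij_inj (dot_bij L h)); rewrite idotK.
by apply: (addrI (dot L h 0)); rewrite -dotDr !addr0.
Qed.

(** The left factor acts first, so a factor peeled off the left of a product is absorbed into the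
    argument [m]. *)
Lemma dot_adj h l m : dot L (adj L h l) m = dot L l (dot L h m).
Proof. by rewrite /adj dotDl idotK. Qed.

Variables (I : zmodType) (A : lcs_action L I) (a f : H -> H -> I).
Hypothesis f_cocycle : is_2cocycle_opp A a f.

Lemma cocycle_adj h l m :
  f (adj L h l) m =
    f l (dot L h m) + dia A l (f h m)
    + prec A (dia A l (f h (idot L h l))) (dot L (adj L h l) m)
    - prec A (dia A (adj L h l) (a h (idot L h l))) (dot L (adj L h l) m).
Proof. by rewrite {1}/adj (cocycle_Dl f_cocycle) !idotK. Qed.

Lemma cocycle_big_adj ell (h : 'I_ell -> H) m :
  f (\big[adj L/0]_(i < ell) h i) m =
    \sum_(j < ell)
      dia A (\big[adj L/0]_(i < ell | (j < i)%N) h i)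
            (f (h j) (dot L (\big[adj L/0]_(i < ell | (i < j)%N) h i) m))
  + \sum_(j < ell | (j.+1 < ell)%N)
      prec A
        (dia A (\big[adj L/0]_(i < ell | (j < i)%N) h i)
           (f (h j)
              (idot L (h j) (\big[adj L/0]_(i < ell | (j < i)%N) h i))))
        (dot L (\big[adj L/0]_(i < ell) h i) m)
  - \sum_(j < ell | (j.+1 < ell)%N)
      prec A
        (dia A (\big[adj L/0]_(i < ell | (j <= i)%N) h i)
           (a (h j)
              (idot L (h j) (\big[adj L/0]_(i < ell | (j < i)%N) h i))))
        (dot L (\big[adj L/0]_(i < ell) h i) m).
Proof.
(* Both [h] and [m] must vary: the induction hypothesis is used for the shifted family and at
   [dot L (h ord0) m]. *)
elim: ell h m => [|ell IH] h m.
  by rewrite !big_ord0 subr0 addr0 (cocycle_l0 f_cocycle).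
(* A single factor is treated apart: the sums over [j.+1 < ell] are then empty, whereas peeling
   would produce terms at [j = 0] for them. *)
case: ell => [|ell] in IH h *.
  rewrite !(big_ord_recl_cond _ 0 +%R) !(big_ord_recl_cond _ 0 (adj L)) !big_ord0 /=.
  by rewrite adjr0 dia0 dot0l !addr0 subr0.
set Q := \big[adj L/0]_(i < ell.+2) h i.
set P := \big[adj L/0]_(i < ell.+1) h (lift ord0 i).
have QE : Q = adj L (h ord0) P by rewrite /Q big_ord_recl.
have gt0 : \big[adj L/0]_(i < ell.+2 | (0 < i)%N) h i = P.
  by rewrite big_ord_recl_cond.
(* Here [bump 0 j] is [j.+1], the value of [lift ord0 j]. The head factor fails the condition in
   [gtS] and [geS] but meets it in [ltS]. *)
have gtS (j : 'I_ell.+1) :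
    \big[adj L/0]_(i < ell.+2 | (bump 0 j < i)%N) h i =
    \big[adj L/0]_(i < ell.+1 | (j < i)%N) h (lift ord0 i).
  by rewrite big_ord_recl_cond.
have geS (j : 'I_ell.+1) :
    \big[adj L/0]_(i < ell.+2 | (bump 0 j <= i)%N) h i =
    \big[adj L/0]_(i < ell.+1 | (j <= i)%N) h (lift ord0 i).
  by rewrite big_ord_recl_cond.
have ltS (j : 'I_ell.+1) :
    \big[adj L/0]_(i < ell.+2 | (i < bump 0 j)%N) h i =
    adj L (h ord0) (\big[adj L/0]_(i < ell.+1 | (i < j)%N) h (lift ord0 i)).
  by rewrite big_ord_recl_cond.
have lt0 : \big[adj L/0]_(i < ell.+2 | (i < 0)%N) h i = 0.
  by rewrite big_pred0.
(* The [dot L P (dot L (h ord0) m)] coming from the induction hypothesis becomes [dot L Q m] by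
   [dot_adj]. *)
rewrite {1}QE cocycle_adj IH -/P -dot_adj -QE [in RHS]big_ord_recl.
(* With at least two factors, [j = 0] satisfies the condition, so both conditional sums split off a
   head term. *)
rewrite ![in RHS](big_ord_recl_cond _ 0 +%R _ (fun j : 'I_ell.+2 => j.+1 < _)%N) /=.
rewrite gt0 lt0 dot0l -/Q opprD.
(* Summands 1 to 3 come from the induction hypothesis; 4 to 6, from [cocycle_adj], are the matching
   [j = 0] terms. *)
rewrite [LHS](ACl ((4 * 1) * (5 * 2) * (6 * 3))%AC) /=.
congr (_ + _ + (_ + _) + (_ - _)); apply: eq_bigr => j _.
- by rewrite gtS ltS dot_adj.
- by rewrite gtS.
- by rewrite geS gtS.
Qed.
End LinearCycleSet.

(* h_1, ..., h_ell are numbered from 0. *)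
Theorem proposition2p37 (n : nat) (d : 'I_n -> nat)
    (d_gt0 : forall i, (0 < d i)%N)
    (L : linear_cycle_set (cyclic_sum d)) (adjC : commutative (adj L))
    (I : zmodType) (A : lcs_action L I) (gamma : 'I_n -> I)
    (f : cyclic_sum d -> cyclic_sum d -> I)
    (f_cocycle : is_2cocycle_opp A (alpha gamma) f)
    (ell : nat) (h : 'I_ell -> cyclic_sum d) (m : cyclic_sum d) :
  f (\big[adj L/0]_(i < ell) h i) m =
    \sum_(j < ell)
      dia A (\big[adj L/0]_(i < ell | (j < i)%N) h i)
            (f (h j) (dot L (\big[adj L/0]_(i < ell | (i < j)%N) h i) m))
  + \sum_(j < ell | (j.+1 < ell)%N)
      prec A
        (dia A (\big[adj L/0]_(i < ell | (j < i)%N) h i)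
           (f (h j)
              (idot L (h j) (\big[adj L/0]_(i < ell | (j < i)%N) h i))))
        (dot L (\big[adj L/0]_(i < ell) h i) m)
  - \sum_(j < ell | (j.+1 < ell)%N)
      prec A
        (dia A (\big[adj L/0]_(i < ell | (j <= i)%N) h i)
           (alpha gamma (h j)
              (idot L (h j) (\big[adj L/0]_(i < ell | (j < i)%N) h i))))
        (dot L (\big[adj L/0]_(i < ell) h i) m).
Proof. exact: cocycle_big_adj. Qed.
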